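(* Let $G=(V,E)$ be a loop-free multigraph. If $\sigma$ is a uniformly random vertex order of $G$, then $\mathbb{E}\left[\sum_{v\in V}\overleftarrow{d}_\sigma(v)\overrightarrow{d}_\sigma(v)\right]\ge \frac13\max_{\tau}\sum_{v\in V}\overleftarrow{d}_\tau(v)\overrightarrow{d}_\tau(v)$, where the maximum is over all vertex orders $\tau$ of $G$.
   Context: A vertex order is a linear ordering $\sigma=(\sigma_1,\dots,\sigma_n)$ of $V$; for $v=\sigma_i$, the left-degree $\overleftarrow{d}_\sigma(v)$ is the number of edges (with multiplicity) joining $v$ to $\{\sigma_1,\dots,\sigma_{i-1}\}$ and the right-degree $\overrightarrow{d}_\sigma(v)$ is the number of edges joining $v$ to $\{\sigma_{i+1},\dots,\sigma_n\}$. *)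

(* Defs.v *)
From mathcomp Require Import all_boot all_order all_algebra.

Set Implicit Arguments.
Unset Strict Implicit.
Unset Printing Implicit Defensive.

Import GRing.Theory Num.Theory.

(* Parallel edges are distinct elements of [edge] with the same set of ends;
   requiring two distinct ends rules out loops. *)
Record multigraph := Multigraph {
  vertex : finType;
  edge : finType;
  ends : edge -> {set vertex};
  ends_card2 : forall e : edge, #|ends e| = 2
}.

(* The sequences listing every vertex exactly once: distinctness of the
   #|vertex G| entries forces exhaustiveness. *)
Definition vorder (G : multigraph) : finType :=
  {s : #|vertex G|.-tuple (vertex G) | uniq s}.

Section Degrees.

Variables (G : multigraph) (s : vorder G).
Implicit Types (v : vertex G) (A : {set vertex G}).

Definition edges_to v A : {set edge G} :=
  [set e | [exists u in A, ends e == [set v; u]]].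

(* [index] is 0-based, so the vertex in 1-based position i has index i - 1. *)
Definition before v : {set vertex G} := [set u in take (index v (val s)) (val s)].

Definition after v : {set vertex G} := [set u in drop (index v (val s)).+1 (val s)].

Definition left_degree v : nat := #|edges_to v (before v)|.

Definition right_degree v : nat := #|edges_to v (after v)|.

Definition degree_product_sum : nat :=
  \sum_(v : vertex G) left_degree v * right_degree v.

End Degrees.

Local Open Scope ring_scope.

(* Expectation of [X] at a uniformly random element of [T]
   (junk value 0 if [T] is empty). *)
Definition uniform_expectation (T : finType) (X : T -> rat) : rat :=
  \sum_(t : T) #|T|%:R^-1 * X t.

(* [vorder G] is never empty, so the uniform distribution on it and the
   maximum over it are genuine. *)
Lemma vorder_gt0 (G : multigraph) : (0 < #|vorder G|)%N.
Proof.
have sz : size (enum (vertex G)) == #|vertex G| by rewrite cardE.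
by apply/card_gt0P; exists (exist _ (Tuple sz) (enum_uniq (vertex G))).
Qed.

(* Main.v *)
Require Import Defs.
From mathcomp Require Import all_boot all_order all_algebra.
From mathcomp Require Import perm zify.

(** With m(v,u) the number of edges joining v and u, the sum of degree products
    is the sum of m(v,u) m(v,w) over the triples with u before v before w.
    Let D be the sum of m(v,u) m(v,w) over all triples of distinct vertices.
    A random order puts three distinct vertices in a prescribed order with
    probability 1/6, so the expectation is D/6; a fixed order counts at most one
    of (u,v,w) and (w,v,u), which have equal weight, so the maximum is at most
    D/2. *)

Set Implicit Arguments.
Unset Strict Implicit.
Unset Printing Implicit Defensive.

Import GRing.Theory Num.Theory.

(** An edge at [v] thus has a unique other end, so edges from [v] into a set can be counted end by
    end. *)
Lemma set2_injr (T : finType) (v : T) : injective (fun u => [set v; u]).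
Proof.
move=> u u' /setP E; have := E u; have := E u'.
by rewrite !inE !eqxx !orbT; do 2 case: eqVneq => //= [->|_]; rewrite ?eqxx //= => /esym/eqP.
Qed.

Section Orders.

Variable G : multigraph.
Implicit Types (s : vorder G) (u v w : vertex G) (A : {set vertex G}).

Definition position s v : nat := index v (val s).

Definition precedes s u v : bool := position s u < position s v.

Lemma mem_vorder s v : v \in tval (val s).
Proof.
have le_size : size (enum (vertex G)) <= size (val s) by rewrite size_tuple cardE.
have [_ ->] := uniq_min_size (valP s) (fun x _ => mem_enum (vertex G) x) le_size.
by rewrite mem_enum.
Qed.

Lemma position_inj s : injective (position s).
Proof. by move=> u v; exact: index_inj (mem_vorder s u) (mem_vorder s v). Qed.

Lemma in_before s u v : (u \in before s v) = precedes s u v.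
Proof. by rewrite inE in_take ?mem_vorder. Qed.

(** As [s] is duplicate-free and exhaustive, the suffix after [v] is the complement of the prefix
    ending with [v]. *)
Lemma in_after s v u : (u \in after s v) = precedes s v u.
Proof.
rewrite inE /precedes ltnNge -ltnS -in_take ?mem_vorder //.
have := valP s; rewrite -{1}(cat_take_drop (index v (val s)).+1 (tval (val s))).
rewrite cat_uniq => /and3P[_ /hasPn disj _].
have := mem_vorder s u.
rewrite -{1}(cat_take_drop (index v (val s)).+1 (tval (val s))) mem_cat.
by case: (boolP (u \in drop _ _)) => [/disj/negPf/= -> | _] //; rewrite orbF => ->.
Qed.

Definition multiplicity v u : nat := #|[set e : edge G | ends e == [set v; u]]|.

Lemma card_edges_to v A : #|edges_to v A| = \sum_(u in A) multiplicity v u.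
Proof.
(* Double counting of the pairs (e, u) with e joining [v] to u; each e lies in at most one such
   pair. *)
transitivity (\sum_e \sum_(u in A) (ends e == [set v; u] : nat)).
  rewrite -sum1_card big_mkcond; apply: eq_bigr => e _; rewrite inE.
  case: exists_inP => [[u uA /eqP eu]|no].
    rewrite (bigD1 u uA) /= eu eqxx big1 // => w /andP[_ wu].
    by rewrite (inj_eq (set2_injr (v := v))) eq_sym (negPf wu).
  by rewrite big1 // => u uA; case: (boolP (_ == _)) => // eu; case: no; exists u.
rewrite exchange_big; apply: eq_bigr => u _.
rewrite /multiplicity -sum1_card [RHS]big_mkcond; apply: eq_bigr => e _.
by rewrite inE; case: (_ == _).
Qed.

Lemma degree_product_sumE s :
  degree_product_sum s =
  \sum_v \sum_u \sum_w
     (precedes s u v && precedes s v w) * (multiplicity v u * multiplicity v w).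
Proof.
apply: eq_bigr => v _; rewrite /left_degree /right_degree !card_edges_to.
rewrite big_mkcond [X in _ * X]big_mkcond big_distrl /=.
apply: eq_bigr => u _; rewrite big_distrr /=; apply: eq_bigr => w _.
by rewrite in_before in_after; case: precedes; case: precedes; rewrite /= ?mul1n ?muln0.
Qed.

Lemma relabel_uniq (p : {perm vertex G}) s : uniq (map_tuple p (val s)).
Proof. by rewrite map_inj_uniq; [exact: (valP s) | exact: perm_inj]. Qed.

Definition relabel (p : {perm vertex G}) s : vorder G :=
  exist _ (map_tuple p (val s)) (relabel_uniq p s).

Lemma relabel_inj p : injective (relabel p).
Proof.
move=> s t /(congr1 (fun x : vorder G => tval (val x))) /= E.
by do 2 apply: val_inj; exact: inj_map (@perm_inj _ p) _ _ E.
Qed.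

Lemma precedes_relabel p s u v : precedes (relabel p s) (p u) (p v) = precedes s u v.
Proof. by rewrite /precedes /position /= !index_map //; exact: perm_inj. Qed.

Definition orders_with u v w : nat :=
  \sum_(s : vorder G) (precedes s u v && precedes s v w).

(** An injective self-map of a finite type is a bijection, so [relabel p] preserves the uniform
    distribution on orders while it carries precedence along [p]. *)
Lemma orders_with_perm (p : {perm vertex G}) u v w : orders_with (p u) (p v) (p w) = orders_with u v w.
Proof.
rewrite /orders_with (reindex_inj (@relabel_inj p)).
by apply: eq_bigr => s _; rewrite !precedes_relabel.
Qed.

Lemma orders_with_swapl u v w :
  w != u -> w != v -> orders_with v u w = orders_with u v w.
Proof.
move=> wu wv; rewrite -(orders_with_perm (tperm u v) u v w).
by rewrite tpermL tpermR tpermD // eq_sym.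
Qed.

Lemma orders_with_swapr u v w :
  u != v -> u != w -> orders_with u w v = orders_with u v w.
Proof.
move=> uv uw; rewrite -(orders_with_perm (tperm v w) u v w).
by rewrite tpermL tpermR tpermD // eq_sym.
Qed.

(** The adjacent swaps generate all six arrangements of three distinct vertices, so these are
    equally frequent, and each order realises exactly one of them. If two vertices coincide, both
    sides are 0. *)
Lemma six_orders_with u v w :
  6 * orders_with u v w = #|vorder G| * uniq [:: u; v; w].
Proof.
rewrite /= !inE negb_or andbT.
have [uv|uv] := eqVneq u v.
  rewrite muln0 /orders_with big1 ?muln0 // => s _.
  by rewrite uv /precedes ltnn.
have [uw|uw] := eqVneq u w.
  rewrite muln0 /orders_with big1 ?muln0 // => s _.
  by rewrite uw /precedes; case: ltngtP.
have [vw|vw] := eqVneq v w.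
  rewrite muln0 /orders_with big1 ?muln0 // => s _.
  by rewrite vw /precedes ltnn andbF.
have E1 : orders_with v u w = orders_with u v w.
  by rewrite orders_with_swapl // eq_sym.
have E2 : orders_with u w v = orders_with u v w by rewrite orders_with_swapr.
(* From here on, one swap leads to an arrangement already settled by an earlier equation. *)
have E3 : orders_with w u v = orders_with u v w.
  by rewrite orders_with_swapl // eq_sym.
have E4 : orders_with v w u = orders_with u v w.
  by rewrite orders_with_swapr // eq_sym.
have E5 : orders_with w v u = orders_with u v w.
  by rewrite orders_with_swapl // eq_sym.
have : orders_with u v w + orders_with v u w + orders_with u w v
       + orders_with w u v + orders_with v w u + orders_with w v u = #|vorder G|.
  rewrite /orders_with -!big_split -sum1_card; apply: eq_bigr => s _ /=.
  move: uv uw vw; rewrite -!(inj_eq (@position_inj s)) /precedes.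
  by do 3 case: ltngtP => //=; lia.
by rewrite E1 E2 E3 E4 E5 /=; lia.
Qed.

Definition distinct_triple_weight : nat :=
  \sum_v \sum_u \sum_w uniq [:: u; v; w] * (multiplicity v u * multiplicity v w).

(** Linearity of expectation: the sum over orders moves inside the sum over triples. *)
Lemma six_sum_degree_product_sum :
  6 * \sum_(s : vorder G) degree_product_sum s = #|vorder G| * distinct_triple_weight.
Proof.
under eq_bigr do rewrite degree_product_sumE.
rewrite exchange_big !big_distrr; apply: eq_bigr => v _ /=.
rewrite exchange_big !big_distrr; apply: eq_bigr => u _ /=.
rewrite exchange_big !big_distrr; apply: eq_bigr => w _.
by rewrite -big_distrl /= !mulnA six_orders_with.
Qed.

Lemma degree_product_sum_le s : 2 * degree_product_sum s <= distinct_triple_weight.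
Proof.
rewrite mul2n -addnn {1}degree_product_sumE degree_product_sumE -big_split.
(* Exchanging [u] and [w] in the second copy pairs each triple with its reversal; the two precedence
   conditions exclude each other, and each forces distinctness. *)
apply: leq_sum => v _ /=; rewrite [X in _ + X]exchange_big -big_split.
apply: leq_sum => u _ /=; rewrite -big_split.
apply: leq_sum => w _ /=.
rewrite [multiplicity v w * _]mulnC -mulnDl leq_mul2r; apply/orP; right.
rewrite !inE negb_or andbT -!(inj_eq (@position_inj s)) /precedes.
by do 3 case: ltngtP => //=; lia.
Qed.

(** The theorem with denominators cleared: [2 * max <= D], multiplied by the number N of orders, is
    compared with [6 * sum = N * D]. *)
Lemma max_degree_product_sum_le :
  #|vorder G| * \max_(t : vorder G) degree_product_sum t
  <= 3 * \sum_(s : vorder G) degree_product_sum s.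
Proof.
(* The maximum is attained because some order exists. *)
have [t ->] := eq_bigmax (@degree_product_sum G) (vorder_gt0 G).
have := six_sum_degree_product_sum; have := degree_product_sum_le t.
by move=> /(leq_mul (leqnn #|vorder G|)); lia.
Qed.

End Orders.

Local Open Scope ring_scope.

Theorem theorem17 (G : multigraph) :
  uniform_expectation
    (fun sigma : vorder G => (degree_product_sum sigma)%:R : rat)
  >= 3%:R^-1 * (\max_(tau : vorder G) degree_product_sum tau)%N%:R.
Proof.
have N0 : 0 < #|vorder G|%:R :> rat by rewrite ltr0n vorder_gt0.
rewrite /uniform_expectation -mulr_sumr -natr_sum ler_pdivrMl // mulrCA.
rewrite ler_pdivlMl // -!natrM ler_nat.
exact: max_degree_product_sum_le.
Qed.
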